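(* Let $\bar X\in\mathbb{R}_{\ge0}^{m\times n}$ and suppose $(p,q)$ are the row and column sums of a draw $Y$ from the biproportional Poisson model with base matrix $\bar X$ and true parameters $(u^*,v^* )$. Let $\mathcal L$ be the Laplacian of $\bar X$ and assume $\lambda_{-2}(\mathcal L)>0$. Let $B>0$, and let $\mathcal B$ be the event that a maximizer $(\hat u,\hat v)$ of $\ell$ exists satisfying the normalization $(\hat u-u^*,\hat v-v^* )\perp\mathbf 1_{m+n}$ and $\|(\hat u,\hat v,u^*,v^* )\|_\infty\le B$. Let $\kappa=\sum_{ij}e^{u^*_i}\bar X_{ij}e^{-v^*_j}$ and $M=\max\{\max_i\sum_je^{u^*_i}\bar X_{ij}e^{-v^*_j},\ \max_j\sum_ie^{u^*_i}\bar X_{ij}e^{-v^*_j}\}$. Then $$\mathbb E\big[\|(\hat u-u^*,\hat v-v^* )\|_2^2\,\mathbf 1_{\mathcal B}\big]\le\frac{8e^{4B}\kappa}{\lambda_{-2}(\mathcal L)^2}.$$ Moreover there is an absolute constant $C>0$ such that for every $\delta\in(0,1)$, with probability at least $1-\delta$, on the event $\mathcal B$, $$\|(\hat u-u^*,\hat v-v^* )\|_2^2\le\frac{8e^{4B}}{\lambda_{-2}(\mathcal L)^2}\Big(\kappa+\sqrt{6\log(4/\delta)\,\kappa(1+M)}+C\log^2(12/\delta)\log^2(1+m+n)(1+M)\Big).$$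
   Context: Biproportional Poisson model: given $\bar X\in\mathbb{R}_{\ge0}^{m\times n}$ and $u\in\mathbb{R}^m$, $v\in\mathbb{R}^n$, entries $Y_{ij}$ are independent with $Y_{ij}\sim\mathrm{Poisson}(e^{u_i}\bar X_{ij}e^{-v_j})$ if $\bar X_{ij}>0$ and $Y_{ij}=0$ otherwise; $p_i=\sum_jY_{ij}$, $q_j=\sum_iY_{ij}$. Log-likelihood: $\ell(u,v)=\sum_ip_iu_i-\sum_jq_jv_j-\sum_{ij}\bar X_{ij}e^{u_i-v_j}$. Laplacian of $\bar X$: the $(m+n)\times(m+n)$ matrix $\mathcal L=\begin{bmatrix}\mathrm{diag}(\bar X\mathbf 1_n)&-\bar X\\-\bar X^T&\mathrm{diag}(\bar X^T\mathbf 1_m)\end{bmatrix}$ (the Laplacian of the weighted bipartite graph with adjacency $\begin{bmatrix}0&\bar X\\\bar X^T&0\end{bmatrix}$); $\lambda_{-2}(\cdot)$ denotes the second-smallest eigenvalue. *)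

(* Defs.v *)
From HB Require Import structures.
From mathcomp Require Import all_boot all_order all_algebra.
From mathcomp Require Import all_classical all_reals all_analysis.
From mathcomp Require Import Rstruct.
Set Implicit Arguments. Unset Strict Implicit. Unset Printing Implicit Defensive.
Import Order.TTheory GRing.Theory Num.Theory.
Local Open Scope ring_scope.

Section BiPoisson.
Variable R : realType.
Variables m n : nat.

(* Poisson(r) probability mass function, valid also for r = 0
   (Poisson(0) is the point mass at 0, since 0^0 = 1). *)
Definition pois_pmf (r : R) (k : nat) : R := r ^+ k / (k`!)%:R * expR (- r).

Definition rate (Xbar : 'M[R]_(m, n)) (u : 'I_m -> R) (v : 'I_n -> R) i j : R :=
  expR (u i) * Xbar i j * expR (- v j).

Definition model_pmf Xbar u v (Y : 'M[nat]_(m, n)) : R :=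
  \prod_(i < m) \prod_(j < n) pois_pmf (rate Xbar u v i j) (Y i j).

(* E[f(Y)] for nonnegative f, and P(Y in A), as sums over the countable
   sample space of count matrices *)
Definition expect Xbar u v (f : 'M[nat]_(m, n) -> R) : \bar R :=
  \esum_(Y in [set: 'M[nat]_(m, n)]) (model_pmf Xbar u v Y * f Y)%:E.
Definition prob Xbar u v (A : set 'M[nat]_(m, n)) : \bar R :=
  \esum_(Y in A) (model_pmf Xbar u v Y)%:E.

Definition rowsum (Y : 'M[nat]_(m, n)) (i : 'I_m) : R := (\sum_(j < n) Y i j)%:R.
Definition colsum (Y : 'M[nat]_(m, n)) (j : 'I_n) : R := (\sum_(i < m) Y i j)%:R.

Definition loglik Xbar (Y : 'M[nat]_(m, n)) (u : 'I_m -> R) (v : 'I_n -> R) : R :=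
  \sum_(i < m) rowsum Y i * u i - \sum_(j < n) colsum Y j * v j
  - \sum_(i < m) \sum_(j < n) Xbar i j * expR (u i - v j).

Definition is_maximizer (Xbar : 'M[R]_(m, n)) Y uh vh : Prop :=
  forall u v, loglik Xbar Y u v <= loglik Xbar Y uh vh.

Definition normalized (uh us : 'I_m -> R) (vh vs : 'I_n -> R) : Prop :=
  \sum_(i < m) (uh i - us i) + \sum_(j < n) (vh j - vs j) = 0.

Definition sup_bounded (uh us : 'I_m -> R) (vh vs : 'I_n -> R) (B : R) : Prop :=
  (forall i, `|uh i| <= B /\ `|us i| <= B) /\ (forall j, `|vh j| <= B /\ `|vs j| <= B).

Definition sqerr (uh us : 'I_m -> R) (vh vs : 'I_n -> R) : R :=
  \sum_(i < m) (uh i - us i) ^+ 2 + \sum_(j < n) (vh j - vs j) ^+ 2.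

Definition eventB (Xbar : 'M[R]_(m, n)) us vs B (Y : 'M[nat]_(m, n)) : Prop :=
  exists uh vh, is_maximizer Xbar Y uh vh /\ normalized uh us vh vs
                /\ sup_bounded uh us vh vs B.

Definition laplacian (Xbar : 'M[R]_(m, n)) : 'M[R]_(m + n) :=
  block_mx (diag_mx (\row_i \sum_(j < n) Xbar i j)) (- Xbar)
           (- Xbar^T) (diag_mx (\row_j \sum_(i < m) Xbar i j)).

Definition kappa Xbar u v : R := \sum_(i < m) \sum_(j < n) rate Xbar u v i j.
Definition maxload Xbar u v : R :=
  Num.max (\big[Num.max/0]_(i < m) \sum_(j < n) rate Xbar u v i j)
          (\big[Num.max/0]_(j < n) \sum_(i < m) rate Xbar u v i j).

End BiPoisson.

(* lam is the second smallest eigenvalue (counted with multiplicity) of the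
   square matrix A: the characteristic polynomial splits over R as
   prod_{x in s} (X - x) with s sorted nondecreasingly, and lam = s_1. *)
Definition is_lambda2 (R : realType) (N : nat) (A : 'M[R]_N) (lam : R) : Prop :=
  exists s : seq R, sorted <=%R s /\ char_poly A = \prod_(x <- s) ('X - x%:P)
                    /\ (1 < size s)%N /\ nth 0 s 1 = lam.

(* Main.v *)
(* On the event B, first-order optimality of the maximizer along the segment
   towards the true parameters, the bound
   (e^x - e^y)(x - y) >= e^{-2B} (x - y)^2 on [-2B, 2B], and the spectral gap of
   the Laplacian on the orthogonal complement of the constants bound the squared
   error by e^{4B} / lambda^2 times the squared norm of the score at the true
   parameters, namely sum_i (p_i - E p_i)^2 + sum_j (q_j - E q_j)^2.  Using
   optimality rather than a comparison of likelihood values gains a factor 4,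
   which leaves room to control the score by exponential moments alone.
   With a = 1 / (8 sqrt (1 + M)), each deviation y satisfies
   E cosh (a y) <= 1 + a^2 E p_i, and y^2 <= 2 (cosh (a y) - 1) / a^2 gives the
   bound in expectation.  For the tail, truncate at |y| <= t = L / a: there
   exp (a y^2 / (4 t)) <= 1 + (cosh (a y) - 1) / (a t), so a Chernoff bound over
   the independent row (or column) sums costs only L log (1/delta) (1 + M), while
   the truncation is paid for by a union bound with the same exponential moment. *)
Require Import Defs.
From HB Require Import structures.
From mathcomp Require Import all_boot all_order all_algebra.
From mathcomp Require Import Rstruct.
From mathcomp Require Import all_classical all_reals all_analysis.
From mathcomp Require Import spectral complex ring lra.
Import Order.TTheory GRing.Theory Num.Theory.
Import numFieldNormedType.Exports.
Set Implicit Arguments. Unset Strict Implicit. Unset Printing Implicit Defensive.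
Local Open Scope ring_scope.

(** * Spectral gap of the Laplacian *)

Section spectral_gap.
Local Open Scope sesquilinear_scope.

Lemma char_poly_similar (F : fieldType) (n : nat) (P D : 'M[F]_n) :
  P \in unitmx -> char_poly (invmx P *m D *m P) = char_poly D.
Proof.
move=> uP; have PVP : map_mx polyC (invmx P) *m map_mx polyC P = 1%:M.
  by rewrite -map_mxM mulVmx// map_mx1.
rewrite /char_poly /char_poly_mx.
have -> : 'X%:M - map_mx polyC (invmx P *m D *m P) =
  map_mx polyC (invmx P) *m ('X%:M - map_mx polyC D) *m map_mx polyC P.
  by rewrite mulmxBr mulmxBl scalar_mxC !map_mxM -[in RHS](mulmxA 'X%:M) PVP mulmx1.
by rewrite !det_mulmx mulrAC -det_mulmx PVP det1 mul1r.
Qed.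

(** The matrix is diagonalized by a unitary matrix over [R[i]]. Since [e] is a null vector, 0 is an
    eigenvalue; the second entry of the sorted spectrum being positive, 0 is the first entry and
    simple. So [e] spans the null line, and [z], orthogonal to it, has coordinates only along
    eigenvalues at least [lam]. *)
Lemma lambda2_quadform (R : realType) (n : nat) (A : 'M[R]_n) (lam : R)
    (e z : 'rV[R]_n) :
  A^T = A -> is_lambda2 A lam -> 0 < lam ->
  e != 0 -> e *m A = 0 -> z *m e^T = 0 ->
  lam * (z *m z^T) 0 0 <= (z *m A *m z^T) 0 0.
Proof.
move=> symA [s [sorted_s [chA [size_s slam]]]] lam0 e0 eA ze.
set f : {rmorphism R -> R[i]} := (real_complex_def (Phant R)).
have fconj x : (f x)^* = f x by apply: conj_Creal; apply/complex_realP; exists x.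
have dotE (u v : 'rV[R[i]]_n) : (u *m v^t*) 0 0 = \sum_i u 0 i * (v 0 i)^*.
  by rewrite mxE; apply: eq_bigr => i _; rewrite !mxE.
have fT m1 m2 (B : 'M[R]_(m1, m2)) : (map_mx f B)^t* = map_mx f B^T.
  by apply/matrixP => i j; rewrite !mxE fconj.
pose Ac := map_mx f A.
have nA : Ac \is normalmx by apply/normalmxP; rewrite fT symA.
set P := spectralmx Ac; set d := spectral_diag Ac.
have AE : Ac = invmx P *m diag_mx d *m P by exact/orthomx_spectralP.
have uP : P \is unitarymx by exact: spectral_unitarymx.
have unP : P \in unitmx by exact: unitarymx_unit.
have PV : invmx P = P^t* by exact: invmx_unitary.
(* Both lists are the roots, with multiplicity, of the same split characteristic polynomial, so they
   agree up to order. *)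
have permd : perm_eq [seq d 0 i | i <- enum 'I_n] [seq f x | x <- s].
  apply: prod_XsubC_eq; rewrite big_map big_enum/= big_map.
  have := char_poly_trig (diag_mx_is_trig d).
  rewrite -(char_poly_similar _ unP) -AE -map_char_poly chA rmorph_prod/=.
  under [LHS]eq_bigr do rewrite rmorphB/= map_polyX map_polyC/=.
  by move=> ->; apply: eq_bigr => i _; rewrite mxE eqxx.
pose w := map_mx f z *m invmx P.
pose e' := map_mx f e *m invmx P.
have e'0 : e' != 0.
  apply: contra_neq e0 => e'0; apply/eqP.
  by rewrite -(map_mx_eq0 f); apply/eqP; rewrite -(mulmxKV unP (map_mx f e)) -/e' e'0 mul0mx.
have e'd i : e' 0 i * d 0 i = 0.
  have : e' *m diag_mx d = 0.
    rewrite /e' -[LHS](mulmxK unP) -!(mulmxA (map_mx f e)) -AE mulmxA.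
    by rewrite -map_mxM eA map_mx0 mul0mx.
  by move=> /matrixP/(_ 0 i); rewrite mul_mx_diag !mxE.
have [i0 e'i0] : exists i, e' 0 i != 0.
  by apply/rV0Pn.
have di0 : d 0 i0 = 0 by apply/eqP; have /eqP := e'd i0; rewrite mulf_eq0 (negbTE e'i0).
(* The value 0 at [i0] must be the head of the sorted list, all later entries being at least
   [lam > 0]. Deleting it on both sides leaves the other eigenvalues in the tail. *)
have dlam i : i != i0 -> f lam <= d 0 i.
  case: s sorted_s size_s slam permd {chA} => [//|x0 [//|x1 s]] /= /andP[x01 xs] _ x1l.
  rewrite {}x1l in x01 xs * => permd ii0.
  have sl x : x \in lam :: s -> lam <= x.
    rewrite inE => /predU1P[->//|]; move: xs.
    by rewrite path_sortedE; [case/andP => /allP h _ /h|exact: le_trans].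
  have i0_enum : i0 \in enum 'I_n by rewrite mem_enum.
  have := perm_map (fun i => d 0 i) (perm_to_rem i0_enum).
  rewrite perm_sym => /perm_trans/(_ permd); rewrite /= di0.
  have : 0 \in [seq f x | x <- [:: x0, lam & s]].
    by rewrite -(perm_mem permd) -di0; apply: map_f.
  rewrite -(rmorph0 f) (mem_map (@complexI _)) inE => /predU1P[<-|/sl]; last first.
    by rewrite leNgt lam0.
  rewrite -[f lam :: _]/([seq f x | x <- lam :: s]) perm_cons => /perm_mem.
  move=> /(_ (d 0 i)).
  have -> : d 0 i \in [seq d 0 i | i <- rem i0 (enum 'I_n)].
    by apply/map_f; rewrite mem_rem_uniq ?enum_uniq// !inE ii0 mem_enum.
  by move=> /esym/mapP[x xs' ->]; rewrite lecR; exact: sl.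
(* The coordinates of [e'] off [i0] vanish because their eigenvalues do not, so orthogonality of [z]
   and [e] is an equation on the [i0] coordinate alone. *)
have wi0 : w 0 i0 = 0.
  have : w *m e'^t* = 0.
    rewrite /e' /w trmx_mul map_mxM/= PV trmxCK fT mulmxA -[_ *m P]mulmxA.
    by rewrite -PV mulVmx// mulmx1 -map_mxM ze map_mx0.
  move=> /matrixP/(_ 0 0); rewrite dotE (bigD1 i0)//= big1 ?addr0; last first.
    move=> i ii0; have di : d 0 i != 0.
      by apply: contraTneq (dlam _ ii0) => ->; rewrite -(rmorph0 f) lecR -ltNge.
    have /eqP := e'd i; rewrite mulf_eq0 (negbTE di) orbF => /eqP ->.
    by rewrite conjC0 mulr0.
  by rewrite [RHS]mxE => /eqP; rewrite mulf_eq0 conjC_eq0 (negbTE e'i0) orbF => /eqP.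
rewrite -lecR -/f rmorphM/=.
have -> : f ((z *m A *m z^T) 0 0) = \sum_i d 0 i * `|w 0 i| ^+ 2.
  have -> : f ((z *m A *m z^T) 0 0) = (w *m diag_mx d *m w^t*) 0 0.
    rewrite /w trmx_mul map_mxM/= [in RHS]PV trmxCK fT -PV.
    rewrite -!mulmxA [invmx P *m (diag_mx d *m _)]mulmxA [_ *m (P *m _)]mulmxA -AE.
    by rewrite -!map_mxM mulmxA [RHS]mxE.
  rewrite dotE; apply: eq_bigr => i _; rewrite mul_mx_diag mxE normCK.
  by rewrite mulrCA mulrA.
have -> : f ((z *m z^T) 0 0) = \sum_i `|w 0 i| ^+ 2.
  have -> : f ((z *m z^T) 0 0) = (w *m w^t*) 0 0.
    rewrite /w trmx_mul map_mxM/= [in RHS]PV trmxCK fT -PV.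
    by rewrite -!mulmxA [invmx P *m _]mulmxA mulVmx// mul1mx -map_mxM [RHS]mxE.
  by rewrite dotE; apply: eq_bigr => i _; rewrite normCK.
rewrite mulr_sumr; apply: ler_sum => i _.
have [->|ii0] := eqVneq i i0; first by rewrite wi0 normr0 expr0n/= !mulr0.
by rewrite ler_wpM2r ?exprn_ge0 ?dlam.
Qed.

End spectral_gap.

Lemma tr_laplacian (R : realType) (m n : nat) (X : 'M[R]_(m, n)) :
  (laplacian X)^T = laplacian X.
Proof. by rewrite /laplacian tr_block_mx !tr_diag_mx !linearN/= trmxK. Qed.

Lemma const_mul_laplacian (R : realType) (m n : nat) (X : 'M[R]_(m, n)) :
  (const_mx 1 : 'rV_(m + n)) *m laplacian X = 0.
Proof.
rewrite -row_mx_const /laplacian mul_row_block -row_mx0.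
congr row_mx; apply/matrixP => i j; rewrite !mxE.
- rewrite (bigD1 j)//= !mxE eqxx mul1r mulr1n [X in _ + X + _]big1 ?addr0 => [|k kj]; last first.
    by rewrite !mxE (negbTE kj) mulr0n mulr0.
  rewrite -big_split/= big1// => k _; rewrite !mxE; ring.
- rewrite addrC (bigD1 j)//= !mxE eqxx mul1r mulr1n [X in _ + X + _]big1 ?addr0 => [|k kj]; last first.
    by rewrite !mxE (negbTE kj) mulr0n mulr0.
  rewrite -big_split/= big1// => k _; rewrite !mxE; ring.
Qed.

Lemma laplacian_quadform (R : realType) (m n : nat) (X : 'M[R]_(m, n))
    (x : 'rV_m) (y : 'rV_n) :
  (row_mx x y *m laplacian X *m (row_mx x y)^T) 0 0 =
  \sum_i \sum_j X i j * (x 0 i - y 0 j) ^+ 2.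
Proof.
rewrite /laplacian mul_row_block tr_row_mx mul_row_col !mulmxDl !mul_mx_diag.
rewrite !mulmxN !mulNmx !mxE.
have -> : \sum_j (\matrix_(i, j) (x i j * (\row_i \sum_(j < n) X i j) 0 j)) 0 j *
    x^T j 0 = \sum_i \sum_j X i j * x 0 i ^+ 2.
  apply: eq_bigr => i _; rewrite !mxE mulr_sumr mulr_suml.
  by apply: eq_bigr => j _; ring.
have -> : \sum_j (\matrix_(i, j) (y i j * (\row_j \sum_(i < m) X i j) 0 j)) 0 j *
    y^T j 0 = \sum_i \sum_j X i j * y 0 j ^+ 2.
  rewrite exchange_big/=; apply: eq_bigr => i _; rewrite !mxE mulr_sumr mulr_suml.
  by apply: eq_bigr => j _; ring.
have -> : \sum_j (x *m X) 0 j * y^T j 0 = \sum_i \sum_j X i j * x 0 i * y 0 j.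
  rewrite exchange_big/=; apply: eq_bigr => i _; rewrite !mxE mulr_suml.
  by apply: eq_bigr => j _; ring.
have -> : \sum_j (y *m X^T) 0 j * x^T j 0 = \sum_i \sum_j X i j * x 0 i * y 0 j.
  apply: eq_bigr => i _; rewrite !mxE mulr_suml.
  by apply: eq_bigr => j _; rewrite !mxE; ring.
rewrite -!sumrN -!big_split/=; apply: eq_bigr => i _.
rewrite -!sumrN -!big_split/=; apply: eq_bigr => j _; ring.
Qed.

(** A Poincaré inequality: the zero-sum hypothesis is orthogonality to the all-ones vector, which
    the Laplacian annihilates. *)
Lemma laplacian_gap (R : realType) (m n : nat) (X : 'M[R]_(m, n)) (lam : R)
    (x : 'I_m -> R) (y : 'I_n -> R) :
  is_lambda2 (laplacian X) lam -> 0 < lam -> \sum_i x i + \sum_j y j = 0 ->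
  lam * (\sum_i x i ^+ 2 + \sum_j y j ^+ 2) <=
  \sum_i \sum_j X i j * (x i - y j) ^+ 2.
Proof.
move=> lam2 lam0 xy0.
have size0 : (0 < m + n)%N.
  have [s [_ [chA [size_s _]]]] := lam2.
  have := size_char_poly (laplacian X); rewrite chA size_prod_XsubC => -[<-].
  exact: leq_trans size_s.
pose e := const_mx 1 : 'rV[R]_(m + n).
have e0 : e != 0.
  apply/eqP => /matrixP/(_ 0 (Ordinal size0)); rewrite !mxE => /eqP.
  by rewrite oner_eq0.
pose xr := \row_i x i; pose yr := \row_j y j.
have ze : row_mx xr yr *m e^T = 0.
  rewrite /e -row_mx_const tr_row_mx mul_row_col; apply/matrixP => i j.
  rewrite !mxE -[RHS]xy0; congr (_ + _).
    by apply: eq_bigr => k _; rewrite !mxE mulr1.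
  by apply: eq_bigr => k _; rewrite !mxE mulr1.
have := @lambda2_quadform _ _ _ _ _ (row_mx xr yr) (tr_laplacian X) lam2 lam0 e0
  (const_mul_laplacian X) ze.
rewrite laplacian_quadform tr_row_mx mul_row_col.
set L := (X in lam * X <= _); set Q := (X in _ <= X).
have -> : L = \sum_i x i ^+ 2 + \sum_j y j ^+ 2.
  by rewrite /L !mxE; congr (_ + _); apply: eq_bigr => k _; rewrite !mxE expr2.
suff -> : Q = \sum_i \sum_j X i j * (x i - y j) ^+ 2 by [].
by apply: eq_bigr => i _; apply: eq_bigr => j _; rewrite !mxE.
Qed.

(** * From the score to the estimation error *)

(** From [expR (- s) >= 1 - s] one gets [expR s * (1 - s) <= 1], while [(1 + s + 2 s^2) (1 - s) = 1
    + s^2 (1 - 2 s)]. *)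
Lemma expR_le_quad2 (R : realType) (s : R) :
  s <= 2^-1 -> expR s <= 1 + s + 2 * s ^+ 2.
Proof.
move=> s2; have h := expR_ge1Dx (- s).
have e0 := expR_gt0 s.
have : expR s * expR (- s) = 1 by rewrite -expRD subrr expR0.
have := ler_wpM2l (ltW e0) h.
move=> + ee; rewrite ee => h2.
have s2' : 0 <= 1 - 2 * s by lra.
suff : expR s * (1 - s) <= (1 + s + 2 * s ^+ 2) * (1 - s).
  by rewrite ler_pM2r//; lra.
apply: (le_trans h2).
have := mulr_ge0 (sqr_ge0 s) s2'; nra.
Qed.

Lemma expR_strong_mono (R : realType) (b x y : R) :
  b <= x -> b <= y -> expR b * (x - y) ^+ 2 <= (expR x - expR y) * (x - y).
Proof.
wlog yx : x y / y <= x => [H bx by_|bx by_].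
  have [|/ltW xy] := leP y x; first by move=> ?; exact: H.
  have := H y x xy by_ bx.
  by rewrite -[X in _ <= X -> _]mulrNN -[X in _ * X <= _ -> _]sqrrN !opprB.
have xy0 : 0 <= x - y by rewrite subr_ge0.
rewrite expr2 mulrA ler_wpM2r//.
have h := expR_ge1Dx (x - y).
have -> : expR x = expR y * expR (x - y) by rewrite -expRD subrKC.
have : expR b <= expR y by rewrite ler_expR.
move=> eby; have := ler_wpM2r xy0 eby.
have := ler_wpM2l (ltW (expR_gt0 y)) h; lra.
Qed.

(** The one-sided first-order condition at the maximizer in the direction of the true parameters. No
    derivative is taken: the maximizer is compared with a point moved by a small [t] towards the
    truth, with a second-order error [2 t^2 K]. *)
Lemma maximizer_directional (R : realType) (m n : nat) (X : 'M[R]_(m, n))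
    (Y : 'M[nat]_(m, n)) (us uh : 'I_m -> R) (vs vh : 'I_n -> R) (B : R) :
  (forall i j, 0 <= X i j) -> 0 < B -> is_maximizer X Y uh vh ->
  sup_bounded uh us vh vs B ->
  \sum_i \sum_j X i j * expR (uh i - vh j) * ((uh i - us i) - (vh j - vs j)) <=
  \sum_i rowsum R Y i * (uh i - us i) - \sum_j colsum R Y j * (vh j - vs j).
Proof.
move=> X0 B0 max_h [bu bv].
pose D i j := (uh i - us i) - (vh j - vs j).
set S := (X in X <= _); set Q := (X in _ <= X).
pose K := \sum_i \sum_j X i j * expR (uh i - vh j) * D i j ^+ 2.
have K0 : 0 <= K.
  apply: sumr_ge0 => i _; apply: sumr_ge0 => j _.
  by rewrite mulr_ge0 ?sqr_ge0 ?mulr_ge0 ?expR_ge0.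
(* Each [D i j] is at most [4 * B] in absolute value, so the condition on [t] keeps [- (t * D i j)]
   below 1/2, the range of [expR_le_quad2]. *)
have step t : 0 < t -> t * (8 * B) <= 1 -> S - Q <= 2 * t * K.
  move=> t0 tB.
  have := max_h (fun i => uh i - t * (uh i - us i)) (fun j => vh j - t * (vh j - vs j)).
  rewrite /loglik.
  have -> : \sum_i rowsum R Y i * (uh i - t * (uh i - us i)) =
      \sum_i rowsum R Y i * uh i - t * \sum_i rowsum R Y i * (uh i - us i).
    by rewrite mulr_sumr -sumrB; apply: eq_bigr => i _; ring.
  have -> : \sum_j colsum R Y j * (vh j - t * (vh j - vs j)) =
      \sum_j colsum R Y j * vh j - t * \sum_j colsum R Y j * (vh j - vs j).
    by rewrite mulr_sumr -sumrB; apply: eq_bigr => i _; ring.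
  set E1 := (X in _ - X <= _) ; set E0 := (X in _ <= _ - X).
  have : E1 <= E0 - t * S + 2 * t ^+ 2 * K.
    rewrite /E1 /E0 /S /K !mulr_sumr -sumrB -big_split/=; apply: ler_sum => i _.
    rewrite !mulr_sumr -sumrB -big_split/=; apply: ler_sum => j _.
    have -> : uh i - t * (uh i - us i) - (vh j - t * (vh j - vs j)) =
      (uh i - vh j) + (- (t * D i j)) by rewrite /D; ring.
    rewrite expRD.
    have := @expR_le_quad2 _ (- (t * D i j)).
    have -> : - (t * D i j) <= 2^-1.
      have [/ler_normlP[h1 h2] /ler_normlP[h3 h4]] := bu i.
      have [/ler_normlP[h5 h6] /ler_normlP[h7 h8]] := bv j.
      have : - D i j <= 4 * B by rewrite /D; lra.
      move=> /(ler_wpM2l (ltW t0)); lra.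
    move=> /(_ isT) /(ler_wpM2l (mulr_ge0 (X0 i j) (expR_ge0 (uh i - vh j)))).
    rewrite mulrA -/(D i j) => /le_trans; apply.
    by rewrite le_eqVlt; apply/orP; left; apply/eqP; ring.
  rewrite /Q; move: (\sum_i rowsum R Y i * _) (\sum_j colsum R Y j * _) => a b.
  move: (\sum_i rowsum R Y i * _) (\sum_j colsum R Y j * _) => a' b' h1 h2.
  have : t * (S - (a' - b')) <= t * (2 * t * K) by lra.
  by rewrite ler_pM2l.
rewrite leNgt; apply/negP => SQ.
(* The first argument makes [t] admissible in [step]; the second gives
   [2 t K <= (S - Q) K / (2 (K + 1)) < S - Q], a contradiction. *)
pose t := Num.min ((8 * B)^-1) ((S - Q) / (4 * (K + 1))).
have SQ0 : 0 < S - Q by rewrite subr_gt0.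
have K1 : 0 < 4 * (K + 1) by lra.
have t0 : 0 < t by rewrite lt_min invr_gt0 divr_gt0 // andbT mulr_gt0.
have := step t t0.
have -> : t * (8 * B) <= 1.
  by rewrite -ler_pdivlMr ?mulr_gt0// mul1r ge_min lexx.
move=> /(_ isT).
have : t * (4 * (K + 1)) <= S - Q.
  by rewrite -ler_pdivlMr// ge_min lexx orbT.
nra.
Qed.

(** Strong monotonicity and the spectral gap give [c * S <= inner], where [inner] pairs the score
    with the error. Young's inequality bounds [2 * inner] by [G / c + c * S], whence
    [S <= G / c^2]. *)
Lemma sqerr_le_score (R : realType) (m n : nat) (X : 'M[R]_(m, n))
    (Y : 'M[nat]_(m, n)) (us uh : 'I_m -> R) (vs vh : 'I_n -> R) (lam B : R) :
  (forall i j, 0 <= X i j) -> is_lambda2 (laplacian X) lam -> 0 < lam -> 0 < B ->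
  is_maximizer X Y uh vh -> normalized uh us vh vs -> sup_bounded uh us vh vs B ->
  sqerr uh us vh vs <= expR (4 * B) / lam ^+ 2 *
    (\sum_i (rowsum R Y i - \sum_j rate X us vs i j) ^+ 2 +
     \sum_j (colsum R Y j - \sum_i rate X us vs i j) ^+ 2).
Proof.
move=> X0 lam2 lam0 B0 max_h norm_h bnd.
have first_order := maximizer_directional X0 B0 max_h bnd.
have gap := laplacian_gap lam2 lam0 norm_h.
case: bnd => bu bv.
set G := (X in _ <= _ * X).
set S := sqerr uh us vh vs.
pose c := expR (- (2 * B)) * lam.
have c0 : 0 < c by rewrite mulr_gt0 ?expR_gt0.
pose mu i := \sum_j rate X us vs i j; pose nu j := \sum_i rate X us vs i j.
pose inner := \sum_i (rowsum R Y i - mu i) * (uh i - us i)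
              - \sum_j (colsum R Y j - nu j) * (vh j - vs j).
have strong : c * S <= inner.
  have : expR (- (2 * B)) * \sum_i \sum_j
      X i j * ((uh i - us i) - (vh j - vs j)) ^+ 2 <=
    \sum_i \sum_j X i j * (expR (uh i - vh j) - expR (us i - vs j)) *
      ((uh i - us i) - (vh j - vs j)).
    rewrite mulr_sumr; apply: ler_sum => i _.
    rewrite mulr_sumr; apply: ler_sum => j _.
    have [/ler_normlP[h1 h2] /ler_normlP[h3 h4]] := bu i.
    have [/ler_normlP[h5 h6] /ler_normlP[h7 h8]] := bv j.
    have := @expR_strong_mono _ (- (2 * B)) (uh i - vh j) (us i - vs j).
    have -> : - (2 * B) <= uh i - vh j by lra.
    have -> : - (2 * B) <= us i - vs j by lra.
    move=> /(_ isT isT) /(ler_wpM2l (X0 i j)).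
    have -> : uh i - us i - (vh j - vs j) = uh i - vh j - (us i - vs j) by ring.
    by move=> h; rewrite mulrCA -mulrA.
  (* The double sum splits into the left side of the first-order condition and the same form at the
     true rates, which supplies the means subtracted in the score. *)
  have -> : \sum_i \sum_j X i j * (expR (uh i - vh j) - expR (us i - vs j)) *
      ((uh i - us i) - (vh j - vs j)) =
     \sum_i \sum_j X i j * expR (uh i - vh j) * ((uh i - us i) - (vh j - vs j)) -
     (\sum_i mu i * (uh i - us i) - \sum_j nu j * (vh j - vs j)).
    have -> : \sum_i mu i * (uh i - us i) - \sum_j nu j * (vh j - vs j) =
      \sum_i \sum_j rate X us vs i j * ((uh i - us i) - (vh j - vs j)).
      rewrite /nu; under [X in _ - X = _]eq_bigr do rewrite mulr_suml.
      rewrite exchange_big/= -sumrB; apply: eq_bigr => i _.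
      rewrite mulr_suml -sumrB; apply: eq_bigr => j _; ring.
    rewrite -sumrB; apply: eq_bigr => i _; rewrite -sumrB; apply: eq_bigr => j _.
    by rewrite /rate !expRD; ring.
  have -> : inner = (\sum_i rowsum R Y i * (uh i - us i) -
                     \sum_j colsum R Y j * (vh j - vs j)) -
     (\sum_i mu i * (uh i - us i) - \sum_j nu j * (vh j - vs j)).
    rewrite /inner.
    under eq_bigr do rewrite mulrBl.
    under [X in _ - X = _]eq_bigr do rewrite mulrBl.
    rewrite !sumrB; ring.
  have := ler_wpM2l (expR_ge0 (- (2 * B))) gap; rewrite mulrA -/c -/S.
  by move=> g1 g2; apply: (le_trans g1); apply: (le_trans g2); rewrite lerB.
have amgm : 2 * inner <= G / c + c * S.
  have young (a b : R) : 2 * (a * b) <= a ^+ 2 / c + c * b ^+ 2.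
    have := sqr_ge0 (a - c * b).
    rewrite -(pmulr_rge0 _ (_ : 0 < c^-1)) ?invr_gt0//.
    have -> : c^-1 * (a - c * b) ^+ 2 = a ^+ 2 / c + c * b ^+ 2 - 2 * (a * b).
      by field; rewrite gt_eqF.
    by rewrite subr_ge0.
  rewrite /inner /G /S /sqerr mulrBr (mulrDl _ _ c^-1) mulrDr !mulr_suml !mulr_sumr addrACA.
  rewrite -!big_split/= -sumrN lerD//; apply: ler_sum => i _; first exact: young.
  have := young (- (colsum R Y i - nu i)) (vh i - vs i).
  by rewrite sqrrN mulNr mulrN.
have cSG : c * S <= G / c by lra.
have -> : expR (4 * B) / lam ^+ 2 = (c ^+ 2)^-1.
  rewrite /c exprMn [RHS]invfM; congr (_ * _).
  by rewrite -expRM_natl -expRN; congr expR; ring.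
rewrite mulrC ler_pdivlMr ?exprn_gt0//.
by move: cSG; rewrite ler_pdivlMr// => h; apply: le_trans h; rewrite le_eqVlt; apply/orP; left; apply/eqP; ring.
Qed.

(** * Matrices of independent Poisson entries *)

Lemma pois_pmf_ge0 (R : realType) (r : R) k : 0 <= r -> 0 <= pois_pmf r k.
Proof. by move=> r0; rewrite mulr_ge0 ?expR_ge0 ?divr_ge0 ?exprn_ge0. Qed.

Lemma pois_pmf_cvg (R : realType) (r : R) :
  ((fun K => \sum_(k < K) pois_pmf r k) @ \oo --> (1 : R))%classic.
Proof.
have -> : (fun K => \sum_(k < K) pois_pmf r k) =
    (fun K => series (exp_coeff r) K * expR (- r)).
  apply/funext => K; rewrite /series/= mulr_suml big_mkord.
  by apply: eq_bigr => k _; rewrite /pois_pmf /exp_coeff.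
rewrite -[X in (_ --> X)%classic](_ : expR r * expR (- r) = 1); last by rewrite -expRD subrr expR0.
by apply: cvgMr_tmp; exact: is_cvg_series_exp_coeff.
Qed.

Lemma pois_pmf_sum_le1 (R : realType) (r : R) K :
  0 <= r -> \sum_(k < K) pois_pmf r k <= 1.
Proof.
move=> r0; rewrite -(cvg_lim _ (@pois_pmf_cvg _ r))//.
apply: (@nondecreasing_cvgn_le _ (fun K => \sum_(k < K) pois_pmf r k)).
  apply/nondecreasing_seqP => n; rewrite big_ord_recr/= lerDl.
  exact: pois_pmf_ge0.
by apply/cvg_ex; exists 1; exact: pois_pmf_cvg.
Qed.

Lemma cvgn_bigprod (R : realType) (I : Type) (s : seq I) (f : I -> nat -> R)
    (l : I -> R) :
  (forall i, (f i @ \oo --> l i)%classic) ->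
  ((fun K => \prod_(i <- s) f i K) @ \oo --> \prod_(i <- s) l i)%classic.
Proof.
move=> fl; elim: s => [|i s IH].
  by rewrite big_nil; under eq_fun do rewrite big_nil; exact: cvg_cst.
by rewrite big_cons; under eq_fun do rewrite big_cons; exact: cvgM.
Qed.

Section poisson_matrix.
Variables (R : realType) (m n : nat).
Implicit Types (r : 'I_m -> 'I_n -> R) (Y : 'M[nat]_(m, n)).

(** The rates are arbitrary here, unlike in [model_pmf], so that the law can be tilted
    exponentially. *)
Definition pois_mx_pmf r Y : R := \prod_(i < m) \prod_(j < n) pois_pmf (r i j) (Y i j).

Lemma pois_mx_pmf_ge0 r Y : (forall i j, 0 <= r i j) -> 0 <= pois_mx_pmf r Y.
Proof.
by move=> r0; apply: prodr_ge0 => i _; apply: prodr_ge0 => j _; exact: pois_pmf_ge0.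
Qed.

(** Finite boxes exhausting the sample space; by distributivity, the mass of a box factors over the
    entries. *)
Definition box_seq K : seq 'M[nat]_(m, n) :=
  [seq \matrix_(i, j) (f (i, j) : nat) | f : {ffun 'I_m * 'I_n -> 'I_K}].

Lemma box_seq_uniq K : uniq (box_seq K).
Proof.
rewrite map_inj_uniq ?enum_uniq// => f g fg; apply/ffunP => -[i j].
by apply: val_inj; move/matrixP: fg => /(_ i j); rewrite !mxE.
Qed.

Lemma mem_box_seq K Y : (forall i j, (Y i j < K)%N) -> Y \in box_seq K.
Proof.
move=> YK; apply/mapP; exists [ffun p => Ordinal (YK p.1 p.2)]; rewrite ?mem_enum//.
by apply/matrixP => i j; rewrite mxE ffunE.
Qed.

Lemma sum_box_seq r K : \sum_(Y <- box_seq K) pois_mx_pmf r Y =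
  \prod_i \prod_j \sum_(k < K) pois_pmf (r i j) k.
Proof.
rewrite pair_big/= (eq_bigr (fun p => \sum_(k < K) pois_pmf (r p.1 p.2) k))//.
rewrite bigA_distr_bigA big_image/=; apply: eq_bigr => f _.
rewrite /pois_mx_pmf pair_big/=; apply: eq_bigr => -[i j] _; by rewrite mxE.
Qed.

(** Every finite set of matrices lies in a box, of mass at most 1; conversely the box masses tend to
    1 and bound the total from below. *)
Lemma esum_pois_mx_pmf r : (forall i j, 0 <= r i j) ->
  \esum_(Y in [set: 'M[nat]_(m, n)]) (pois_mx_pmf r Y)%:E = 1%E.
Proof.
move=> r0; apply/eqP; rewrite eq_le; apply/andP; split.
  apply: ge_ereal_sup => _ [A [/finite_seqP[s ->] _] <-].
  (* The successor is taken because a box holds entries strictly below [K]. *)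
  pose K := (\max_(Y <- s) \max_i \max_j Y i j).+1.
  have sK : ([set` s] `<=` [set` box_seq K])%classic.
    move=> Y /= Ys; apply: mem_box_seq => i j; rewrite ltnS.
    apply: leq_trans (@leq_bigmax_seq _ s xpredT (fun Y => \max_i \max_j Y i j) Y Ys isT).
    apply: leq_trans (leq_bigmax i).
    exact: (leq_bigmax j).
  apply: (@le_trans _ _ (\sum_(Y \in [set` box_seq K]) (pois_mx_pmf r Y)%:E)%E).
    apply: lee_fsum_nneg_subset.
    - exact: finite_seq.
    - exact: finite_seq.
    - by move=> Y; rewrite !inE; exact: sK.
    - by move=> Y _; rewrite lee_fin pois_mx_pmf_ge0.
  rewrite -fsbig_seq ?box_seq_uniq// sumEFin lee_fin sum_box_seq.
  apply: prodr_ile1 => i _; apply/andP; split.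
    by apply: prodr_ge0 => j _; apply: sumr_ge0 => k _; exact: pois_pmf_ge0.
  apply: prodr_ile1 => j _; rewrite pois_pmf_sum_le1// andbT.
  by apply: sumr_ge0 => k _; exact: pois_pmf_ge0.
have cvg1 : ((fun K => \prod_i \prod_j \sum_(k < K) pois_pmf (r i j) k) @ \oo -->
    \prod_(i < m) \prod_(j < n) (1 : R))%classic.
  by do 2![apply: cvgn_bigprod => ?]; exact: pois_pmf_cvg.
rewrite [X in (_ --> X)%classic](_ : _ = 1) in cvg1; last by rewrite !big1// => ? _; rewrite big1.
set S := esum _ _.
case: (leP 1%E S) => // S1; exfalso.
have S0 : (0 <= S)%E by apply: esum_ge0 => Y _; rewrite lee_fin pois_mx_pmf_ge0.
have Sfin : S \is a fin_num by rewrite ge0_fin_numE// (lt_trans S1)// ltry.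
move: S1; rewrite -(fineK Sfin) lte_fin ltNge => /negP; apply.
rewrite -[leLHS](cvg_lim _ cvg1)//; apply: limr_le; first by apply/cvg_ex; exists 1.
apply: nearW => K; rewrite -sum_box_seq -lee_fin fineK// -sumEFin.
apply: esum_ge; exists [set` box_seq K]%classic; first by split; [exact: finite_seq|exact: subsetT].
by rewrite [leLHS]fsbig_seq ?box_seq_uniq.
Qed.
End poisson_matrix.

(** * Elementary inequalities for exp and cosh *)

Lemma expR_ge_quad (R : realType) (h : R) : 0 <= h -> 1 + h + h ^+ 2 / 2 <= expR h.
Proof.
move=> h0; have := @nondecreasing_cvgn_le _ (series (exp_coeff h)) _ _ 3%N.
have -> : series (exp_coeff h) 3%N = 1 + h + h ^+ 2 / 2.
  rewrite /series/= !big_nat_recr//= big_nil /exp_coeff/= !factS fact0 !muln1.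
  by rewrite add0r expr0 expr1 !divr1.
apply; last exact: is_cvg_series_exp_coeff.
apply/nondecreasing_seqP => n; rewrite /series/= big_nat_recr//= lerDl.
by rewrite /exp_coeff/= divr_ge0 ?exprn_ge0.
Qed.

Definition cosh (R : realType) (x : R) : R := (expR x + expR (- x)) / 2.

Lemma expRMN (R : realType) (x : R) : expR x * expR (- x) = 1.
Proof. by rewrite -expRD subrr expR0. Qed.

Lemma cosh_ge1 (R : realType) (x : R) : 1 <= cosh x.
Proof.
have := sqr_ge0 (expR (x / 2) - expR (- (x / 2))).
have := expRMN (x / 2).
have -> : cosh x = (expR (x / 2) ^+ 2 + expR (- (x / 2)) ^+ 2) / 2.
  by rewrite /cosh -!expRM_natl; congr ((expR _ + expR _) / _); field.
nra.
Qed.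

(** This is [|h| <= |sinh h|]. For [h >= 0], [x^2 - 2 h x] grows from [x = q] to [x = expR h], and
    at [q] it equals [1 + h^4 / 4]; multiplying by [expR (- h)] concludes. *)
Lemma sqr_le_sinh2 (R : realType) (h : R) :
  4 * h ^+ 2 <= (expR h - expR (- h)) ^+ 2.
Proof.
wlog h0 : h / 0 <= h => [H|].
  have [|/ltW] := leP 0 h; first exact: H.
  by rewrite -oppr_ge0 => /H; rewrite sqrrN opprK -[X in _ <= X -> _]sqrrN opprB.
set q := 1 + h + h ^+ 2 / 2.
have q1 : 1 <= q by rewrite /q; have := sqr_ge0 h; lra.
have eq := expR_ge_quad h0; rewrite -/q in eq.
have ee := expRMN h; have e0 := expR_gt0 (- h).
have E : 2 * h <= expR h - expR (- h).
  have : 1 <= expR h * expR h - 2 * h * expR h.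
    apply: (@le_trans _ _ (q * q - 2 * h * q)).
      have : 0 <= (h ^+ 2) ^+ 2 by exact: sqr_ge0.
      rewrite /q; lra.
    have : 0 <= expR h + q - 2 * h.
      by rewrite /q in eq *; have := sqr_ge0 (h - 0); lra.
    have : 0 <= expR h - q by lra.
    by move=> h1 h2; have := mulr_ge0 h1 h2; lra.
  move=> /(ler_wpM2r (ltW e0)); rewrite mul1r.
  have -> : (expR h * expR h - 2 * h * expR h) * expR (- h) =
    (expR h - 2 * h) * (expR h * expR (- h)) by ring.
  by rewrite ee mulr1; lra.
have -> : 4 * h ^+ 2 = (2 * h) ^+ 2 by ring.
by rewrite lerXn2r// nnegrE; lra.
Qed.

(** With [E = expR (x / 4)] and [F] its inverse, [cosh x - 1 = (E - F)^2 (E + F)^2 / 2]. The extra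
    factor [cosh (x / 4)] later absorbs an exponential. *)
Lemma cosh_ge_quad (R : realType) (x : R) : x ^+ 2 / 2 * cosh (x / 4) <= cosh x - 1.
Proof.
set E := expR (x / 4); set F := expR (- (x / 4)).
have EF : E * F = 1 by exact: expRMN.
have hs : (x / 2) ^+ 2 <= (E - F) ^+ 2.
  have := sqr_le_sinh2 (x / 4); rewrite -/E -/F.
  by have -> : 4 * (x / 4) ^+ 2 = (x / 2) ^+ 2 by field.
have c1 : 2 <= E + F by have := cosh_ge1 (x / 4); rewrite /cosh -/E -/F; lra.
have -> : cosh x = (E ^+ 4 + F ^+ 4) / 2.
  by rewrite /cosh /E /F -!expRM_natl; congr ((expR _ + expR _) / _); field.
have -> : (E ^+ 4 + F ^+ 4) / 2 - 1 = (E - F) ^+ 2 * (E + F) ^+ 2 / 2.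
  have EF2 : (E * F) ^+ 2 = 1 by rewrite EF expr1n.
  by rewrite -[X in _ - X]EF2; field.
rewrite /cosh -/E -/F.
have -> : x ^+ 2 / 2 * ((E + F) / 2) = (x / 2) ^+ 2 * (2 * (E + F)) / 2 by field.
rewrite ler_pM2r// ler_pM ?sqr_ge0//; first by lra.
by rewrite expr2 ler_wpM2r//; lra.
Qed.

Lemma sqr_le_cosh (R : realType) (x : R) : x ^+ 2 / 2 <= cosh x - 1.
Proof.
apply: le_trans (cosh_ge_quad x); rewrite ler_peMr ?cosh_ge1//.
by rewrite divr_ge0 ?sqr_ge0.
Qed.

Lemma expR_abs_le_cosh (R : realType) (x : R) : expR `|x| <= 2 * cosh x.
Proof.
rewrite /cosh mulrC divfK//.
by case: (ger0P x) => _; rewrite ?lerDl ?lerDr expR_ge0.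
Qed.

(* The truncation at [t] turns [lam y^2] into at most [a |y| / 4], which the
   exponential moments of [y] control. *)
Lemma expR_sqr_trunc (R : realType) (a t y : R) : 0 < a -> 0 < t -> `|y| <= t ->
  expR (a / (4 * t) * y ^+ 2) <= 1 + (a * t)^-1 * (cosh (a * y) - 1).
Proof.
move=> a0 t0 yt; set s := a / (4 * t) * y ^+ 2.
have s0 : 0 <= s by rewrite mulr_ge0 ?sqr_ge0// divr_ge0 ?ltW// mulr_gt0.
have sy : s <= `|a * y / 4|.
  rewrite !normrM (gtr0_norm a0) [`|4^-1|]ger0_norm// /s -(real_normK (num_real y)).
  have -> : a / (4 * t) * `|y| ^+ 2 = a * `|y| / 4 * (`|y| / t) by field; rewrite gt_eqF.
  by rewrite ler_piMr ?divr_ge0 ?mulr_ge0 ?(ltW a0)// ler_pdivrMr// mul1r.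
(* Keeping the factor [s] in front makes the bound quadratic in [y], as [cosh_ge_quad] requires. *)
have es : expR s <= 1 + s * expR s.
  have := expR_ge1Dx (- s) => /(ler_wpM2l (expR_ge0 s)).
  by rewrite expRMN; lra.
apply: (le_trans es); rewrite lerD2l.
have h : expR s <= 2 * cosh (a * y / 4).
  by apply: le_trans (expR_abs_le_cosh _); rewrite ler_expR.
apply: (@le_trans _ _ (s * (2 * cosh (a * y / 4)))); first by rewrite ler_wpM2l.
have at0 : 0 < (a * t)^-1 by rewrite invr_gt0 mulr_gt0.
have -> : s * (2 * cosh (a * y / 4)) =
    (a * t)^-1 * ((a * y) ^+ 2 / 2 * cosh (a * y / 4)).
  by rewrite /s; field; rewrite !gt_eqF.
by rewrite ler_pM2l//; exact: cosh_ge_quad.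
Qed.

(** Obtained by squaring [expR (a / 2) * (1 - a / 2) <= 1]. A coefficient below 1 leaves room for
    the second-order term in [pois_mgf_le]. *)
Lemma expR_le_quad9 (R : realType) (a : R) : `|a| <= 8^-1 ->
  expR a <= 1 + a + 9 / 10 * a ^+ 2.
Proof.
move=> /ler_normlP[a1 a2].
have h := expR_ge1Dx (- (a / 2)).
have ee := expRMN (a / 2); have e0 := expR_gt0 (a / 2).
have -> : expR a = expR (a / 2) ^+ 2 by rewrite -expRM_natl; congr expR; field.
have h2 : expR (a / 2) * (1 - a / 2) <= 1 by rewrite -[leRHS]ee ler_pM2l.
have p0 : 0 < 1 - a / 2 by lra.
have : (expR (a / 2) * (1 - a / 2)) ^+ 2 <= 1.
  by rewrite expr_le1// mulr_ge0 ?ltW.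
rewrite exprMn => h3.
suff : expR (a / 2) ^+ 2 * (1 - a / 2) ^+ 2 <=
    (1 + a + 9 / 10 * a ^+ 2) * (1 - a / 2) ^+ 2.
  by rewrite ler_pM2r// exprn_gt0.
apply: (le_trans h3).
have : 0 <= a ^+ 2 * (3 / 20 - 13 / 20 * a + 9 / 40 * a ^+ 2).
  apply: mulr_ge0; first exact: sqr_ge0.
  have := sqr_ge0 a; lra.
lra.
Qed.

(** The left side is the moment generating function of a centred Poisson variable. With
    [x = mu * a^2 <= 1/64], the exponent is at most [9/10 x], and [9/10 x + 2 (9/10 x)^2 <= x]. *)
Lemma pois_mgf_le (R : realType) (mu a : R) : 0 <= mu -> `|a| <= 8^-1 ->
  mu * a ^+ 2 <= 64^-1 -> expR (mu * (expR a - 1 - a)) <= 1 + mu * a ^+ 2.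
Proof.
move=> mu0 a8 ma.
have ma0 : 0 <= mu * a ^+ 2 by rewrite mulr_ge0 ?sqr_ge0.
apply: (@le_trans _ _ (expR (9 / 10 * (mu * a ^+ 2)))).
  rewrite ler_expR mulrCA ler_wpM2l//.
  have := expR_le_quad9 a8; lra.
apply: le_trans (expR_le_quad2 _) _; first by lra.
have := ler_wpM2l ma0 ma; lra.
Qed.

(** * Concentration of sums of squared Poisson deviations *)

Section mean.
Variables (R : realType) (T : choiceType) (P : T -> R).
Hypothesis P0 : forall x, 0 <= P x.
Implicit Types (f g : T -> R).

Definition mean f : \bar R := \esum_(x in [set: T]) (P x * f x)%:E.

Lemma le_mean f g : (forall x, f x <= g x) -> (mean f <= mean g)%E.
Proof. by move=> fg; apply: le_esum => x _; rewrite lee_fin ler_wpM2l. Qed.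

Lemma eq_mean f g : (forall x, f x = g x) -> mean f = mean g.
Proof. by move=> fg; congr mean; exact/funext. Qed.

Lemma meanD f g : (forall x, 0 <= f x) -> (forall x, 0 <= g x) ->
  mean (fun x => f x + g x) = (mean f + mean g)%E.
Proof.
move=> f0 g0; rewrite /mean -esumD => [|x _|x _]; rewrite ?lee_fin ?mulr_ge0//.
by apply: eq_esum => x _; rewrite mulrDr EFinD.
Qed.

Lemma mean_leD f g u v : (forall x, 0 <= f x) -> (forall x, 0 <= g x) ->
  (mean f <= u%:E)%E -> (mean g <= v%:E)%E ->
  (mean (fun x => f x + g x)%R <= (u + v)%:E)%E.
Proof. by move=> f0 g0 fu gv; rewrite meanD// EFinD leeD. Qed.

(** Stated as an inequality, it can be checked on finite partial sums; [mean_eqZ] recovers equality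
    by scaling back with the inverse. *)
Lemma mean_leZ c f u : 0 <= c -> (mean f <= u%:E)%E ->
  (mean (fun x => c * f x)%R <= (c * u)%:E)%E.
Proof.
move=> c0 fu; apply: ge_ereal_sup => _ [A [finA _] <-].
have -> : (\sum_(x \in A) (P x * (c * f x))%:E = c%:E * \sum_(x \in A) (P x * f x)%:E)%E.
  rewrite !fsbig_finite// !sumEFin -EFinM mulr_sumr; congr EFin.
  by apply: eq_bigr => x _; rewrite mulrCA.
rewrite EFinM lee_wpmul2l ?lee_fin//; apply: le_trans fu.
by apply: ereal_sup_ubound; exists A.
Qed.

Lemma mean_le_sum (I : Type) (s : seq I) (f : I -> T -> R) (u : I -> R) :
  (forall i x, 0 <= f i x) -> (forall i, (mean (f i) <= (u i)%:E)%E) ->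
  (mean (fun x => (\sum_(i <- s) f i x)%R) <= (\sum_(i <- s) u i)%:E)%E.
Proof.
move=> f0 fu; elim: s => [|i s IH].
  by rewrite big_nil /mean esum1// => x _; rewrite big_nil mulr0.
rewrite big_cons (@eq_mean _ (fun x => f i x + \sum_(i <- s) f i x)); last first.
  by move=> x; rewrite big_cons.
by apply: mean_leD => // x; apply: sumr_ge0.
Qed.

(** Markov's inequality, with [f] a majorant of the indicator of [A]. *)
Lemma prob_le_mean (A : set T) f u : (forall x, 0 <= f x) ->
  (forall x, A x -> 1 <= f x) -> (mean f <= u%:E)%E ->
  (\esum_(x in A) (P x)%:E <= u%:E)%E.
Proof.
move=> f0 f1 fu; rewrite esum_mkcond; apply: le_trans fu.
apply: le_esum => x _; case: ifPn => [/set_mem Ax|_].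
  by rewrite lee_fin ler_peMr// f1.
by rewrite lee_fin mulr_ge0.
Qed.

End mean.

Section poisson_concentration.
Variables (R : realType) (T : choiceType) (P : T -> R).
Hypothesis P0 : forall x, 0 <= P x.
Variables (I : finType) (y : T -> I -> R) (mu : I -> R) (a : R).
Hypothesis mu0 : forall i, 0 <= mu i.
(** This joint moment generating function encodes that the [y x i] are independent centred Poisson
    variables of parameters [mu i]; [c = 0] gives total mass 1. It covers row sums and column sums
    alike. *)
Hypothesis mgf : forall c : I -> R,
  mean P (fun x => \prod_i expR (c i * y x i)) =
  (\prod_i expR (mu i * (expR (c i) - 1 - c i)))%:E.
Hypothesis a0 : 0 < a.
Hypothesis a8 : a <= 8^-1.
Hypothesis mua : forall i, mu i * a ^+ 2 <= 64^-1.

Let kap := \sum_i mu i.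

Lemma mgf1 i (b : R) :
  mean P (fun x => expR (b * y x i)) = (expR (mu i * (expR b - 1 - b)))%:E.
Proof.
have := mgf (fun k => if k == i then b else 0).
rewrite (bigD1 i)//= eqxx big1 ?mulr1 => [<-|k /negbTE ->]; last first.
  by rewrite expR0 subrr subr0 mulr0 expR0.
apply: eq_mean => x; rewrite (bigD1 i)//= eqxx big1 ?mulr1// => k /negbTE ->.
by rewrite mul0r expR0.
Qed.

Lemma mean1 : mean P (fun=> 1) = 1%:E.
Proof.
have := mgf (fun=> 0); rewrite big1 => [<-|i _]; last first.
  by rewrite expR0 subrr subr0 mulr0 expR0.
by apply: eq_mean => x; rewrite big1// => i _; rewrite mul0r expR0.
Qed.

Lemma mgf1_le i (b : R) : b = a \/ b = - a ->
  (mean P (fun x => expR (b * y x i))%R <= (1 + mu i * a ^+ 2)%:E)%E.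
Proof.
move=> ba; have b2 : b ^+ 2 = a ^+ 2 by case: ba => ->; rewrite ?sqrrN.
have bn : `|b| <= 8^-1 by case: ba => ->; rewrite ?normrN gtr0_norm.
by rewrite mgf1 lee_fin -b2 pois_mgf_le// b2.
Qed.

Lemma mean_cosh_le i :
  (mean P (fun x => cosh (a * y x i))%R <= (1 + mu i * a ^+ 2)%:E)%E.
Proof.
have -> : 1 + mu i * a ^+ 2 = 2^-1 * ((1 + mu i * a ^+ 2) + (1 + mu i * a ^+ 2)).
  by field.
rewrite (@eq_mean _ _ _ _ (fun x => 2^-1 * (expR (a * y x i) + expR (- a * y x i)))).
  apply: mean_leZ => //; apply: mean_leD.
  - exact: P0.
  - by move=> x; exact: expR_ge0.
  - by move=> x; exact: expR_ge0.
  - by apply: mgf1_le; left.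
  - by apply: mgf1_le; right.
by move=> x; rewrite /cosh mulrC mulNr.
Qed.

Lemma mean_coshB1_le i :
  (mean P (fun x => cosh (a * y x i) - 1)%R <= (mu i * a ^+ 2)%:E)%E.
Proof.
have := mean_cosh_le i.
rewrite (@eq_mean _ _ _ _ (fun x => 1 + (cosh (a * y x i) - 1))); last first.
  by move=> x; rewrite subrKC.
rewrite (@meanD _ _ _ P0 (fun=> 1)) => [|x|x]; rewrite ?ler01 ?subr_ge0 ?cosh_ge1//.
by rewrite mean1 EFinD leeD2lE.
Qed.

Lemma mean_sqr_le i : (mean P (fun x => y x i ^+ 2)%R <= (2 * mu i)%:E)%E.
Proof.
have -> : 2 * mu i = 2 / a ^+ 2 * (mu i * a ^+ 2) by field; rewrite gt_eqF.
have c0 : 0 <= 2 / a ^+ 2 by rewrite divr_ge0 ?sqr_ge0.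
apply: le_trans (mean_leZ c0 (mean_coshB1_le i)).
apply: le_mean => // x; have := sqr_le_cosh (a * y x i).
move=> /(ler_wpM2l c0); apply: le_trans.
by rewrite le_eqVlt; apply/orP; left; apply/eqP; field; rewrite gt_eqF.
Qed.

Lemma mean_sqsum_le : (mean P (fun x => (\sum_i y x i ^+ 2)%R) <= (2 * kap)%:E)%E.
Proof.
by rewrite mulr_sumr; apply: mean_le_sum => // [i x|i];
  [exact: sqr_ge0|exact: mean_sqr_le].
Qed.

(** Each factor is a convex combination of the exponentials of 0, [a * y] and [- a * y]. Expanding
    the product over all choices leaves exponentials of linear forms, whose means [mgf] gives
    exactly; the result is then refolded into a product. *)
Lemma mean_prod_cosh_le (b : R) : 0 <= b <= 1 ->
  (mean P (fun x => (\prod_i (1 + b * (cosh (a * y x i) - 1)))%R) <=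
   (expR (b * a ^+ 2 * kap))%:E)%E.
Proof.
move=> /andP[b0 b1].
pose c (k : 'I_3) : R := nth 0 [:: 1 - b; b / 2; b / 2] k.
pose e (k : 'I_3) : R := nth 0 [:: 0; a; - a] k.
have c0 k : 0 <= c k.
  by case: k => -[|[|[|k]]] ik //; rewrite /c/= ?subr_ge0 ?divr_ge0.
pose phi i k := expR (mu i * (expR (e k) - 1 - e k)).
have expand x : \prod_i (1 + b * (cosh (a * y x i) - 1)) =
    \sum_(f : {ffun I -> 'I_3})
      (\prod_i c (f i)) * \prod_i expR (e (f i) * y x i).
  under [RHS]eq_bigr do rewrite -big_split/=.
  rewrite -(bigA_distr_bigA (fun i k => c k * expR (e k * y x i)))/=.
  apply: eq_bigr => i _; rewrite !big_ord_recr big_ord0/= /c /e/=.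
  by rewrite mul0r expR0 mulNr /cosh; field.
rewrite (eq_mean P expand).
apply: (@le_trans _ _ (\sum_(f : {ffun I -> 'I_3})
    (\prod_i c (f i)) * \prod_i phi i (f i))%:E).
  apply: mean_le_sum => // [f x|f].
    by rewrite mulr_ge0// prodr_ge0// => i _; rewrite expR_ge0.
  by apply: mean_leZ; [rewrite prodr_ge0|rewrite mgf].
under eq_bigr do rewrite -big_split/=.
rewrite -(bigA_distr_bigA (fun i k => c k * phi i k))/= lee_fin.
rewrite /kap mulr_sumr expR_sum; apply: ler_prod => i _; apply/andP; split.
  by apply: sumr_ge0 => k _; rewrite mulr_ge0// expR_ge0.
apply: le_trans (expR_ge1Dx _).
rewrite !big_ord_recr big_ord0/= /c /phi /e/= expR0 subrr subr0 mulr0 expR0.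
have an : `|a| <= 8^-1 by rewrite gtr0_norm.
have h1 := pois_mgf_le (mu0 i) an (mua i).
rewrite -normrN in an; rewrite -sqrrN in h1.
have h2 := @pois_mgf_le _ _ (- a) (mu0 i) an.
rewrite sqrrN in h1 h2; have {}h2 := h2 (mua i).
have b20 : 0 <= b / 2 by rewrite divr_ge0.
have := ler_wpM2l b20 h1; have := ler_wpM2l b20 h2.
lra.
Qed.

(** The indicator of the bad event is dominated by [F1 + F2]: [F1] pays for some deviation exceeding
    [t = L1 / a], and [F2] is the Chernoff weight when all deviations are within [t]. *)
Lemma sqsum_tail (L1 L2 : R) : 1 <= L1 -> 0 <= L2 ->
  (\esum_(x in [set x | 4 * kap + 4 * L1 * L2 / a ^+ 2 < \sum_i y x i ^+ 2]%R%classic) (P x)%:E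
   <= (3 * #|I|%:R * expR (- L1) + expR (- L2))%:E)%E.
Proof.
move=> L11 L20; have L10 : 0 < L1 by lra.
pose t := L1 / a; have t0 : 0 < t by exact: divr_gt0.
pose lam := a / (4 * t).
have lam0 : 0 < lam by rewrite divr_gt0// mulr_gt0.
pose b := (a * t)^-1.
have bE : b = L1^-1 by rewrite /b /t mulrC divfK ?gt_eqF.
pose thr := 4 * kap + 4 * L1 * L2 / a ^+ 2.
have lamE : lam = L1^-1 * a ^+ 2 / 4 by rewrite /lam /t; field; rewrite !gt_eqF.
have cosh0 z : 0 <= cosh z :> R by apply: le_trans (cosh_ge1 z).
have H0 z : 0 <= 1 + b * (cosh z - 1).
  by rewrite addr_ge0// mulr_ge0 ?subr_ge0 ?cosh_ge1// bE invr_ge0 ltW.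
pose F1 x := \sum_i 2 * expR (- L1) * cosh (a * y x i).
pose F2 x := expR (- (lam * thr)) * \prod_i (1 + b * (cosh (a * y x i) - 1)).
have F10 x : 0 <= F1 x.
  by apply: sumr_ge0 => i _; rewrite !mulr_ge0 ?expR_ge0.
have F20 x : 0 <= F2 x by rewrite mulr_ge0 ?expR_ge0// prodr_ge0.
apply: (@prob_le_mean _ _ _ _ _ (fun x => F1 x + F2 x)) => //.
- by move=> x; rewrite addr_ge0.
- move=> x /= bad.
  have [/existsP[i yi]|/existsPn ally] := boolP [exists i, t < `|y x i|].
    rewrite ler_wpDr// /F1 (bigD1 i)//= ler_wpDr//.
      by apply: sumr_ge0 => k _; rewrite !mulr_ge0 ?expR_ge0.
    have := expR_abs_le_cosh (a * y x i).
    move=> /(ler_wpM2l (expR_ge0 (- L1))); rewrite -expRD mulrA [_ * 2]mulrC.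
    apply: le_trans; rewrite -expR0 ler_expR normrM gtr0_norm//.
    by rewrite addrC subr_ge0 mulrC -ler_pdivrMr// ltW.
  rewrite ler_wpDl// /F2.
  apply: (@le_trans _ _ (expR (- (lam * thr)) * \prod_i expR (lam * y x i ^+ 2))).
    rewrite -expR_sum -expRD -expR0 ler_expR -mulr_sumr addrC subr_ge0.
    by rewrite ler_pM2l// ltW.
  rewrite ler_wpM2l ?expR_ge0//; apply: ler_prod => i _; rewrite expR_ge0/=.
  by apply: expR_sqr_trunc => //; rewrite leNgt ally.
apply: mean_leD => //.
(* The factor 3/2 generously bounds [1 + mu i * a^2 <= 1 + 1/64]. *)
- have -> : 3 * #|I|%:R * expR (- L1) = \sum_(i : I) 2 * expR (- L1) * (3 / 2).
    by rewrite sumr_const -mulr_natl; field.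
  apply: mean_le_sum => // [i x|i]; first by rewrite !mulr_ge0 ?expR_ge0.
  apply: mean_leZ; first by rewrite mulr_ge0 ?expR_ge0.
  apply: le_trans (mean_cosh_le i) _; rewrite lee_fin; have := mua i; lra.
(* The threshold is calibrated so that [lam * thr = b * a^2 * kap + L2]: the first summand cancels
   the bound on the mean and leaves [expR (- L2)]. *)
- have bb : 0 <= b <= 1 by rewrite bE invr_ge0 invf_le1// (ltW L10).
  have := mean_leZ (expR_ge0 (- (lam * thr))) (mean_prod_cosh_le bb).
  move=> /le_trans; apply; rewrite lee_fin -expRD ler_expR.
  rewrite le_eqVlt; apply/orP; left; apply/eqP.
  by rewrite lamE bE /thr; field; rewrite !gt_eqF.
Qed.

End poisson_concentration.

Lemma mean_eqZ (R : realType) (T : choiceType) (P : T -> R) (f : T -> R) (c u : R) :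
  (forall x, 0 <= P x) -> (forall x, 0 <= f x) -> 0 < c -> mean P f = u%:E ->
  mean P (fun x => c * f x) = (c * u)%:E.
Proof.
move=> P0 f0 c0 fu; apply/eqP; rewrite eq_le mean_leZ ?(ltW c0) ?fu//=.
have S0 : (0 <= mean P (fun x => c * f x)%R)%E.
  by apply: esum_ge0 => x _; rewrite lee_fin !mulr_ge0// ltW.
have Sfin : mean P (fun x => c * f x) \is a fin_num.
  rewrite ge0_fin_numE//; apply: (@le_lt_trans _ _ (c * u)%:E); last exact: ltry.
  by rewrite mean_leZ ?(ltW c0) ?fu.
have ci0 : 0 <= c^-1 by rewrite invr_ge0 ltW.
have Sle : (mean P (fun x => c * f x)%R <= (fine (mean P (fun x => c * f x)%R))%:E)%E.
  by rewrite fineK.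
have := mean_leZ ci0 Sle.
have -> : mean P (fun x => c^-1 * (c * f x)) = u%:E.
  by rewrite -fu; apply: eq_mean => x; rewrite mulrA mulVf ?mul1r ?gt_eqF.
rewrite lee_fin -[X in (_ <= X)%E]fineK// lee_fin.
by rewrite -(ler_pM2l c0) mulrA divff ?mul1r ?gt_eqF.
Qed.

(** * Moment generating functions of the row and column sums *)

Section poisson_matrix_mgf.
Variables (R : realType) (m n : nat) (r : 'I_m -> 'I_n -> R).
Hypothesis r0 : forall i j, 0 <= r i j.

(** Exponential tilting: weighting Poisson([r i j]) by [expR (d i j * k)] gives, up to a constant,
    Poisson([r i j * expR (d i j)]). The tilted law has mass 1, so the constant is the mean. *)
Lemma pois_mx_mgf (d : 'I_m -> 'I_n -> R) :
  mean (pois_mx_pmf r)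
    (fun Y => expR (\sum_i \sum_j d i j * ((Y i j)%:R - r i j))) =
  (expR (\sum_i \sum_j r i j * (expR (d i j) - 1 - d i j)))%:E.
Proof.
set c := expR (\sum_i \sum_j r i j * _).
pose r' i j := r i j * expR (d i j).
have r'0 i j : 0 <= r' i j by rewrite mulr_ge0 ?expR_ge0.
have := @mean_eqZ _ _ (pois_mx_pmf r') (fun=> 1) c 1 _ _ (expR_gt0 _).
rewrite mulr1 => <- //.
- apply: eq_esum => Y _; congr EFin; rewrite /pois_mx_pmf /c !expR_sum.
  rewrite -!big_split/=; apply: eq_bigr => i _.
  rewrite !expR_sum -!big_split/=; apply: eq_bigr => j _.
  rewrite /pois_pmf /r' exprMn -expRM_natl -!mulrA; congr (_ * _).
  rewrite [RHS]mulrCA; congr (_ * _); rewrite -!expRD; congr expR; ring.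
- by move=> Y; exact: pois_mx_pmf_ge0.
- rewrite /mean; under eq_esum do rewrite mulr1.
  by rewrite esum_pois_mx_pmf.
Qed.

Lemma rowsum_mgf (c : 'I_m -> R) :
  mean (pois_mx_pmf r)
    (fun Y => \prod_i expR (c i * (rowsum R Y i - \sum_j r i j))) =
  (\prod_i expR ((\sum_j r i j) * (expR (c i) - 1 - c i)))%:E.
Proof.
have := pois_mx_mgf (fun i _ => c i); rewrite expR_sum.
under [X in _ = X%:E -> _]eq_bigr do rewrite -mulr_suml.
move=> <-; apply: eq_mean => Y; rewrite -expR_sum; congr expR.
by apply: eq_bigr => i _; rewrite -mulr_sumr sumrB -natr_sum.
Qed.

Lemma colsum_mgf (c : 'I_n -> R) :
  mean (pois_mx_pmf r)
    (fun Y => \prod_j expR (c j * (colsum R Y j - \sum_i r i j))) =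
  (\prod_j expR ((\sum_i r i j) * (expR (c j) - 1 - c j)))%:E.
Proof.
have := pois_mx_mgf (fun _ j => c j); rewrite exchange_big/= expR_sum.
under [X in _ = X%:E -> _]eq_bigr do rewrite -mulr_suml.
move=> <-; apply: eq_mean => Y; rewrite -expR_sum exchange_big/=; congr expR.
by apply: eq_bigr => i _; rewrite -mulr_sumr sumrB -natr_sum.
Qed.

End poisson_matrix_mgf.

(** * The score at the true parameters *)

Section score.
Variables (R : realType) (m n : nat) (X : 'M[R]_(m, n)).
Variables (us : 'I_m -> R) (vs : 'I_n -> R).
Hypothesis X0 : forall i j, 0 <= X i j.

Let r := rate X us vs.
Let M := maxload X us vs.
Let kap := kappa X us vs.
Let P := pois_mx_pmf r.
Let row_dev (Y : 'M[nat]_(m, n)) i := rowsum R Y i - \sum_j r i j.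
Let col_dev (Y : 'M[nat]_(m, n)) j := colsum R Y j - \sum_i r i j.
(** This scale meets both smallness conditions of the concentration bounds: [a <= 1/8], and
    [mu * a^2 <= 1/64] for every row or column mean, since these are at most [M]. *)
Let a := (8 * Num.sqrt (1 + M))^-1.

Lemma rate_ge0 i j : 0 <= r i j.
Proof. by rewrite !mulr_ge0 ?expR_ge0. Qed.

Lemma maxload_ge0 : 0 <= M.
Proof. by rewrite le_max bigmax_ge_id. Qed.

Lemma kappa_ge0 : 0 <= kap.
Proof. by apply: sumr_ge0 => i _; apply: sumr_ge0 => j _; exact: rate_ge0. Qed.

Lemma row_rate_le i : \sum_j r i j <= M.
Proof. by rewrite le_max (le_bigmax _ (fun i => \sum_j r i j)). Qed.

Lemma col_rate_le j : \sum_i r i j <= M.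
Proof. by rewrite le_max (le_bigmax _ (fun j => \sum_i r i j)) orbT. Qed.

Lemma kappa_cols : \sum_j \sum_i r i j = kap.
Proof. by rewrite exchange_big. Qed.

Let sqrt_gt0 : 0 < Num.sqrt (1 + M).
Proof. by rewrite sqrtr_gt0; have := maxload_ge0; lra. Qed.

Let scale_gt0 : 0 < a.
Proof. by rewrite invr_gt0 mulr_gt0. Qed.

Let scale_sqr : a ^+ 2 = (64 * (1 + M))^-1.
Proof.
rewrite /a exprVn exprMn sqr_sqrtr; last by have := maxload_ge0; lra.
by congr (_ * _)^-1; ring.
Qed.

Let scale_le : a <= 8^-1.
Proof.
rewrite /a lef_pV2 ?posrE ?mulr_gt0// ler_peMr//.
by rewrite -[leLHS]sqrtr1 ler_sqrt; have := maxload_ge0; lra.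
Qed.

Let scale_mul x : x <= M -> x * a ^+ 2 <= 64^-1.
Proof.
have M1 : 0 < 1 + M by have := maxload_ge0; lra.
move=> xM; rewrite scale_sqr ler_pdivrMr ?mulr_gt0// mulrA mulVf ?mul1r//.
lra.
Qed.

Let P_ge0 Y : 0 <= P Y.
Proof. by apply: pois_mx_pmf_ge0; exact: rate_ge0. Qed.

(** Row means and column means both add up to [kap], so each family contributes [2 * kap]. *)
Lemma mean_score_le :
  (mean P (fun Y => (\sum_i row_dev Y i ^+ 2 + \sum_j col_dev Y j ^+ 2)%R)
   <= (4 * kap)%:E)%E.
Proof.
have -> : 4 * kap = 2 * kap + 2 * kap by ring.
apply: mean_leD => //.
- by move=> Y; apply: sumr_ge0 => i _; exact: sqr_ge0.
- by move=> Y; apply: sumr_ge0 => i _; exact: sqr_ge0.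
- apply: (mean_sqsum_le P_ge0 _ (rowsum_mgf rate_ge0) scale_gt0 scale_le).
    by move=> i; apply: sumr_ge0 => j _; exact: rate_ge0.
  by move=> i; apply/scale_mul/row_rate_le.
- rewrite -kappa_cols.
  apply: (mean_sqsum_le P_ge0 _ (colsum_mgf rate_ge0) scale_gt0 scale_le).
    by move=> i; apply: sumr_ge0 => j _; exact: rate_ge0.
  by move=> i; apply/scale_mul/col_rate_le.
Qed.

Let thr (L1 L2 : R) := 4 * kap + 256 * L1 * L2 * (1 + M).

Let thrE L1 L2 : 4 * kap + 4 * L1 * L2 / a ^+ 2 = thr L1 L2.
Proof. by rewrite scale_sqr invrK /thr; ring. Qed.

Lemma row_tail (L1 L2 : R) : 1 <= L1 -> 0 <= L2 ->
  (\esum_(Y in [set Y | thr L1 L2 < \sum_i row_dev Y i ^+ 2]%R%classic) (P Y)%:E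
   <= (3 * m%:R * expR (- L1) + expR (- L2))%:E)%E.
Proof.
move=> L11 L20; rewrite -thrE -[m in leRHS]card_ord.
apply: (sqsum_tail P_ge0 _ (rowsum_mgf rate_ge0) scale_gt0 scale_le) => //.
  by move=> i; apply: sumr_ge0 => j _; exact: rate_ge0.
by move=> i; apply/scale_mul/row_rate_le.
Qed.

Lemma col_tail (L1 L2 : R) : 1 <= L1 -> 0 <= L2 ->
  (\esum_(Y in [set Y | thr L1 L2 < \sum_j col_dev Y j ^+ 2]%R%classic) (P Y)%:E
   <= (3 * n%:R * expR (- L1) + expR (- L2))%:E)%E.
Proof.
move=> L11 L20; rewrite -thrE -[n in leRHS]card_ord -kappa_cols.
apply: (sqsum_tail P_ge0 _ (colsum_mgf rate_ge0) scale_gt0 scale_le) => //.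
  by move=> i; apply: sumr_ge0 => j _; exact: rate_ge0.
by move=> i; apply/scale_mul/col_rate_le.
Qed.

End score.

(** * Calibration of the constants and the final union bound *)

Lemma is_lambda2_size (R : realType) (n : nat) (A : 'M[R]_n) (lam : R) :
  is_lambda2 A lam -> (1 < n)%N.
Proof.
move=> [s [_ [chA [size_s _]]]].
by have := size_char_poly A; rewrite chA size_prod_XsubC => -[<-].
Qed.

(** Subadditivity, used to bound the probability of [A] from below when [B] and [C] are the
    exceptional events. *)
Lemma le_esum_cover3 (R : realType) (T : choiceType) (f : T -> \bar R) (A B C : set T) :
  (forall x, (0 <= f x)%E) -> (forall x, ~ B x -> ~ C x -> A x) ->
  (\esum_(x in [set: T]) f x <=
   \esum_(x in A) f x + \esum_(x in B) f x + \esum_(x in C) f x)%E.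
Proof.
move=> f0 ABC; rewrite (esum_mkcond A) (esum_mkcond B) (esum_mkcond C).
have if0 (D : set T) x : (0 <= if x \in D then f x else 0)%E by case: ifP.
rewrite -!esumD//; last by move=> x _; rewrite adde_ge0.
apply: le_esum => x _; case: ifPn => [_|/negP xA].
  by rewrite -addeA leeDl// adde_ge0.
case: ifPn => [_|/negP xB]; first by rewrite add0e leeDl.
case: ifPn => [_|/negP xC]; first by rewrite !add0e.
by exfalso; apply: xA; apply/mem_set/ABC => [/mem_set|/mem_set].
Qed.

Lemma expR_half_le2 (R : realType) : expR (2^-1 : R) <= 2.
Proof. by apply: le_trans (expR_le_quad2 (lexx _)) _; lra. Qed.

Lemma expR1_le4 (R : realType) : expR (1 : R) <= 4.
Proof.
have -> : (1 : R) = 2%:R * 2^-1 by rewrite divff.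
rewrite expRM_natl; have := expR_half_le2 R; have := expR_ge0 (2^-1 : R); nra.
Qed.

(** The left side adds the row and column thresholds; [s] stands for the square-root term. The
    constant arises from [L1 * L2 <= 6 Ld^2 l^2] and [2 * 256 * 6 = 8 * 384]. *)
Lemma score_threshold_le (R : realType) (N : nat) (delta M kap s : R) :
  (1 < N)%N -> 0 < delta < 1 -> 0 <= M -> 0 <= s ->
  2 * (4 * kap + 256 * ln (6 * N%:R / delta) * ln (4 / delta) * (1 + M)) <=
  8 * (kap + s + 384 * ln (12 / delta) ^+ 2 * ln (1 + N%:R) ^+ 2 * (1 + M)).
Proof.
move=> N1 /andP[d0 d1] M0 s0.
have N2 : 2 <= N%:R :> R by rewrite ler_nat.
set Ld := ln (12 / delta); set l := ln (1 + N%:R); set L1 := ln (6 * _ / _).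
set L2 := ln (4 / delta).
have dV : 1 < delta^-1 by rewrite invf_gt1.
have Ld1 : 1 <= Ld.
  rewrite /Ld -[leLHS](@expRK R) ler_ln ?posrE ?expR_gt0//; last by lra.
  by have := expR1_le4 R; lra.
have l2 : 2^-1 <= l.
  rewrite /l -[leLHS](@expRK R) ler_ln ?posrE ?expR_gt0//.
  by have := expR_half_le2 R; lra.
have L20 : 0 <= L2 by rewrite ln_ge0//; lra.
have L2d : L2 <= Ld by rewrite ler_ln ?posrE ?divr_gt0// ler_pM2r ?invr_gt0// ler_nat.
have L1d : L1 <= Ld + l.
  rewrite -lnM ?posrE; [|lra|lra].
  rewrite ler_ln ?posrE; [|by rewrite !mulr_gt0 ?invr_gt0//; lra|
    by rewrite !mulr_gt0 ?invr_gt0//; lra].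
  rewrite [leRHS]mulrAC ler_pM2r ?invr_gt0//; lra.
(* Since [l >= 1/2] and [Ld >= 1], the summands [Ld] and [l] are at most 4 and 2 times
   [Ld * l^2]. *)
have L1e : L1 <= 6 * (Ld * l ^+ 2).
  have l4 : 4^-1 <= l ^+ 2.
    by rewrite expr2; apply: le_trans (ler_pM _ _ l2 l2) => //; lra.
  have h1 : Ld <= 4 * (Ld * l ^+ 2).
    have := @ler_wpM2l _ Ld _ _ _ l4; rewrite (le_trans ler01 Ld1) => /(_ isT); lra.
  have h2 : l <= 2 * l ^+ 2.
    have := @ler_wpM2l _ l _ _ _ l2; rewrite (le_trans _ l2)// => /(_ isT).
    by rewrite expr2; lra.
  have h3 : 2 * l ^+ 2 <= 2 * (Ld * l ^+ 2).
    by rewrite ler_pM2l// ler_peMl// sqr_ge0.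
  lra.
have prod : L1 * L2 <= 6 * (Ld ^+ 2 * l ^+ 2).
  apply: (@le_trans _ _ (6 * (Ld * l ^+ 2) * L2)); first by rewrite ler_wpM2r.
  apply: (@le_trans _ _ (6 * (Ld * l ^+ 2) * Ld)).
    by rewrite ler_wpM2l// !mulr_ge0 ?sqr_ge0//; lra.
  by rewrite le_eqVlt; apply/orP; left; apply/eqP; ring.
have M1 : 0 <= 1 + M by lra.
have := ler_wpM2r M1 prod; lra.
Qed.

Theorem mainTheorem4 :
  (forall (m n : nat) (Xbar : 'M[Rdefinitions.R]_(m, n))
          (us : 'I_m -> Rdefinitions.R) (vs : 'I_n -> Rdefinitions.R)
          (lam2 B : Rdefinitions.R)
          (uh : 'M[nat]_(m, n) -> 'I_m -> Rdefinitions.R)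
          (vh : 'M[nat]_(m, n) -> 'I_n -> Rdefinitions.R),
     (forall i j, 0 <= Xbar i j) ->
     is_lambda2 (laplacian Xbar) lam2 -> 0 < lam2 -> 0 < B ->
     (* (uh Y, vh Y) is a maximizer witnessing the event B whenever B holds *)
     (forall Y, eventB Xbar us vs B Y ->
        is_maximizer Xbar Y (uh Y) (vh Y) /\ normalized (uh Y) us (vh Y) vs
        /\ sup_bounded (uh Y) us (vh Y) vs B) ->
     (expect Xbar us vs (fun Y => if `[< eventB Xbar us vs B Y >]
                                  then sqerr (uh Y) us (vh Y) vs else 0)%R
      <= (8 * expR (4 * B) * kappa Xbar us vs / lam2 ^+ 2)%:E)%E)
  /\
  (exists C : Rdefinitions.R, 0 < C /\
   forall (m n : nat) (Xbar : 'M[Rdefinitions.R]_(m, n))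
          (us : 'I_m -> Rdefinitions.R) (vs : 'I_n -> Rdefinitions.R)
          (lam2 B : Rdefinitions.R)
          (uh : 'M[nat]_(m, n) -> 'I_m -> Rdefinitions.R)
          (vh : 'M[nat]_(m, n) -> 'I_n -> Rdefinitions.R)
          (delta : Rdefinitions.R),
     (forall i j, 0 <= Xbar i j) ->
     is_lambda2 (laplacian Xbar) lam2 -> 0 < lam2 -> 0 < B ->
     (forall Y, eventB Xbar us vs B Y ->
        is_maximizer Xbar Y (uh Y) (vh Y) /\ normalized (uh Y) us (vh Y) vs
        /\ sup_bounded (uh Y) us (vh Y) vs B) ->
     0 < delta < 1 ->
     ((1 - delta)%R%:E <=
      prob Xbar us vs
        [set Y | (eventB Xbar us vs B Y ->
           sqerr (uh Y) us (vh Y) vs <=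
           8 * expR (4 * B) / lam2 ^+ 2 *
           (kappa Xbar us vs
            + Num.sqrt (6 * ln (4 / delta) * kappa Xbar us vs
                        * (1 + maxload Xbar us vs))
            + C * ln (12 / delta) ^+ 2 * ln (1 + (m + n)%:R) ^+ 2
                * (1 + maxload Xbar us vs)))%R])%E).
Proof.
split=> [m n X us vs lam2 B uh vh X0 l2 lam0 B0 max_h|].
  pose K := expR (4 * B) / lam2 ^+ 2.
  have K0 : 0 <= K by rewrite divr_ge0 ?expR_ge0 ?sqr_ge0.
  have k0 := kappa_ge0 us vs X0.
  have := mean_leZ K0 (mean_score_le us vs X0).
  set b1 := (X in (_ <= X)%E -> _).
  have b1_le : (b1 <= (8 * expR (4 * B) * kappa X us vs / lam2 ^+ 2)%:E)%E.
    have -> : 8 * expR (4 * B) * kappa X us vs / lam2 ^+ 2 = K * (8 * kappa X us vs).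
      by rewrite /K; field; rewrite gt_eqF.
    by rewrite lee_fin ler_wpM2l//; lra.
  move=> /le_trans/(_ b1_le); apply: le_trans; apply: le_mean => Y.
    by apply: pois_mx_pmf_ge0; exact: rate_ge0.
  case: ifPn => [/asboolP eB|_].
    by have [mh [nh bh]] := max_h Y eB; exact: sqerr_le_score.
  by rewrite mulr_ge0// addr_ge0// sumr_ge0// => i _; exact: sqr_ge0.
exists 384; split=> // m n X us vs lam2 B uh vh delta X0 l2 lam0 B0 max_h dl.
have N1 := is_lambda2_size l2.
have /andP[d0 d1] := dl.
have N2 : 2 <= (m + n)%:R :> Rdefinitions.R by rewrite ler_nat.
have dV : 1 < delta^-1 by rewrite invf_gt1.
(* With these choices the row and column truncations cost [3 (m + n) expR (- L1) = delta / 2] in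
   all, and the two Chernoff bounds cost [2 expR (- L2) = delta / 2]. *)
pose L1 := ln (6 * (m + n)%:R / delta); pose L2 := ln (4 / delta).
have N6 : 12 < 6 * (m + n)%:R / delta.
  by rewrite ltr_pdivlMr//; apply: (@lt_le_trans _ _ 12); lra.
have L11 : 1 <= L1.
  rewrite /L1 -[leLHS]expRK ler_ln ?posrE ?expR_gt0//; last by lra.
  by have := expR1_le4 Rdefinitions.R; lra.
have L20 : 0 <= L2 by rewrite ln_ge0//; lra.
have rt := row_tail us vs X0 L11 L20; have ct := col_tail us vs X0 L11 L20.
have r0 : forall i j, 0 <= rate X us vs i j by exact: rate_ge0.
have tot := esum_pois_mx_pmf r0.
set A := (X in prob _ _ _ X).
have cover : (1 <= prob X us vs A + delta%:E)%E.
  rewrite -tot.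
  apply: le_trans (@le_esum_cover3 _ _ _ A _ _ _ _) _; last first.
  - rewrite -addeA leeD2l//; apply: le_trans (leeD rt ct) _.
    rewrite -EFinD lee_fin /L1 /L2 !expRN !lnK ?posrE; [|lra|lra].
    rewrite le_eqVlt; apply/orP; left; apply/eqP; rewrite natrD; field.
    by rewrite gt_eqF//= -natrD gt_eqF//; lra.
  (* Outside both tail events the score is at most twice the threshold, which gives the required
     bound whenever [eventB] holds. *)
  - move=> Y /= /negP; rewrite -leNgt => hr /negP; rewrite -leNgt => hc eB.
    have [mh [nh bh]] := max_h Y eB.
    apply: le_trans (sqerr_le_score X0 l2 lam0 B0 mh nh bh) _.
    have K0 : 0 <= expR (4 * B) / lam2 ^+ 2 by rewrite divr_ge0 ?expR_ge0 ?sqr_ge0.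
    rewrite -[8 * _ / _]mulrA [8 * (_ / _)]mulrC -[leRHS]mulrA ler_wpM2l//.
    have M0 := maxload_ge0 X us vs.
    have := score_threshold_le (kappa X us vs) N1 dl M0
      (sqrtr_ge0 (6 * ln (4 / delta) * kappa X us vs * (1 + maxload X us vs))).
    by apply: le_trans; apply: le_trans (lerD hr hc) _; rewrite [leRHS]mulr_natl mulr2n.
  - by move=> Y; rewrite lee_fin; exact: pois_mx_pmf_ge0.
by rewrite EFinB leeBlDr.
Qed.
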